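(* For $\alpha\in(0,0.1]$, let $\phi_\alpha:\mathbb{R}\to\mathbb{R}$ be the function $$\phi_\alpha(x)=\begin{cases}2x-2\alpha,& x\in[\alpha,+\infty);\\ x+\alpha\log(\frac{x}{\alpha})-\alpha,& x\in[\alpha\exp(-\frac1\alpha),\alpha];\\ x-\alpha\log(\frac{x}{\alpha})+2\exp(\frac1\alpha)x-3\alpha-2,& x\in[\frac12\alpha\exp(-\frac1\alpha),\alpha\exp(-\frac1\alpha)];\\ x+\alpha(\log2-2)-1,& x\in(-\infty,\frac12\alpha\exp(-\frac1\alpha)],\end{cases}$$ and consider the problem of minimizing $f_\alpha(x_1,x_2):=\frac12\phi_\alpha(x_1)\cdot(x_2+0.05)$ subject to $x_1,x_2\in[0,1]$. Apply the Bregman proximal gradient method with the Burg entropy kernel $\varphi(x)=-\log(x)$, constant step size $t=0.5$ and initialization $\boldsymbol x^0=(1,0.1)$, and let $\{\boldsymbol x^k\}_{k\in\mathbb{N}}$ denote the resulting sequence of iterates (which depends on $\alpha$). Let $\tilde{\boldsymbol x}^\star=(0,0)$. Then for any given $K\in\mathbb{N}$ and $\epsilon\in(0,1]$, there exist a parameter $\alpha\in(0,0.1]$ and an iteration index $k_1>0$ such that the iterates satisfy $$\boldsymbol x^k\in\mathbb{B}_\epsilon(\tilde{\boldsymbol x}^\star)\quad\text{for all }k_1\le k\le K+k_1.$$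
   Context: $\mathbb{B}_\epsilon(\boldsymbol x)=\{\boldsymbol y:\|\boldsymbol x-\boldsymbol y\|\le\epsilon\}$ (Euclidean ball). Bregman proximal gradient method (BPG): with $h(\boldsymbol x)=\varphi(x_1)+\varphi(x_2)$ and $D_h(\boldsymbol y,\boldsymbol x)=h(\boldsymbol y)-h(\boldsymbol x)-\nabla h(\boldsymbol x)^\top(\boldsymbol y-\boldsymbol x)$, the iterates are $$\boldsymbol x^{k+1}=\operatorname*{argmin}_{\boldsymbol y\in[0,1]^2}\Big\{f_\alpha(\boldsymbol x^k)+\nabla f_\alpha(\boldsymbol x^k)^\top(\boldsymbol y-\boldsymbol x^k)+\frac1tD_h(\boldsymbol y,\boldsymbol x^k)\Big\}.$$ For $\varphi(x)=-\log x$, $\operatorname{dom}\varphi=(0,\infty)$, so $h(\boldsymbol y)=+\infty$ if some $y_i\le0$. *)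

(* Defs.v *)
From Stdlib Require Import Reals.
From Coquelicot Require Import Coquelicot.
Open Scope R_scope.

(* Points of the plane are pairs; Coquelicot's norm on the product R * R is
   the Euclidean one, sqrt (|x1|^2 + |x2|^2). *)
Definition eball (eps : R) (x y : R * R) : Prop := norm (minus x y) <= eps.

Definition dot (u v : R * R) : R := fst u * fst v + snd u * snd v.

(* Vector of partial derivatives.  [Derive] is total; it is used below only for
   C^1 functions, or at points near which the function is smooth. *)
Definition grad (f : R * R -> R) (x : R * R) : R * R :=
  (Derive (fun u => f (u, snd x)) (fst x),
   Derive (fun v => f (fst x, v)) (snd x)).

Definition unit_square (y : R * R) : Prop :=
  (0 <= fst y <= 1) /\ (0 <= snd y <= 1).

Definition is_argmin (C : R * R -> Prop) (F : R * R -> Rbar) (y : R * R) : Prop :=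
  C y /\ forall z, C z -> Rbar_le (F y) (F z).

Definition separable (phi : R -> Rbar) (y : R * R) : Rbar :=
  Rbar_plus (phi (fst y)) (phi (snd y)).

(* The Bregman divergence D_h(y, x).  It is meaningful for x in the interior of
   dom h, where [h x] is finite and [real] is harmless near x; it is then
   +infinity exactly when [h y] is. *)
Definition bregman (h : R * R -> Rbar) (y x : R * R) : Rbar :=
  Rbar_minus (Rbar_minus (h y) (h x))
             (Finite (dot (grad (fun z => real (h z)) x) (minus y x))).

Definition bpg_model (f : R * R -> R) (h : R * R -> Rbar) (t : R)
    (x y : R * R) : Rbar :=
  Rbar_plus (Finite (f x + dot (grad f x) (minus y x)))
            (Rbar_mult (Finite (1 / t)) (bregman h y x)).

(* "x (k+1) = argmin" is read as: x (k+1) is the one and only minimizer.  Hence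
   at most one sequence satisfies this predicate for given data. *)
Definition is_bpg (f : R * R -> R) (h : R * R -> Rbar) (C : R * R -> Prop)
    (t : R) (x0 : R * R) (x : nat -> R * R) : Prop :=
  x 0%nat = x0 /\
  forall k : nat, unique (is_argmin C (bpg_model f h t (x k))) (x (S k)).

(* With phi = burg and C = unit_square, every iterate started in the open
   positive quadrant stays there, since the model is +infinity elsewhere. *)
Definition burg (u : R) : Rbar :=
  if Rlt_dec 0 u then Finite (- ln u) else p_infty.

(* The neighbouring formulas agree at the shared breakpoints. *)
Definition phi_alpha (alpha x : R) : R :=
  if Rle_dec alpha x then 2 * x - 2 * alpha
  else if Rle_dec (alpha * exp (- (1 / alpha))) x then
    x + alpha * ln (x / alpha) - alpha
  else if Rle_dec (1 / 2 * alpha * exp (- (1 / alpha))) x then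
    x - alpha * ln (x / alpha) + 2 * exp (1 / alpha) * x - 3 * alpha - 2
  else x + alpha * (ln 2 - 2) - 1.

Definition f_alpha (alpha : R) (x : R * R) : R :=
  1 / 2 * phi_alpha alpha (fst x) * (snd x + 5 / 100).

(* Main.v *)
(** With the Burg kernel the model separates: each coordinate minimizes
    [a y - ln y] over [(0, 1]] with [a = 1/x_i + t g_i], so the reciprocal of
    the new coordinate is [Rmax 1 a].  Write [u = 1/x_1] and [v = 1/x_2].  While
    [x_1 > 2 alpha], [u] grows by at most [1] and at least [1/40] per step, and
    [v] by at least [1/(4u)]; hence [v] grows logarithmically, by divergence of
    the harmonic series.  For [alpha] of order [1/N] this lasts [N] steps, so
    [u] and [v] both become as large as desired, [v] with a margin of [K].
    Afterwards [u] never decreases, since [phi_alpha] is nondecreasing, and [v]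
    drops by at most [1] per step, since [phi_alpha >= -4] on the nonnegative
    axis. *)
Require Import Defs.
From Stdlib Require Import Reals Lra Lia.
From Coquelicot Require Import Coquelicot.
Open Scope R_scope.

(** * Elementary inequalities and the scalar problem of minimizing [a y - ln y] *)

Lemma ln_le_sub_1 (r : R) : 0 < r -> ln r <= r - 1.
Proof.
intros hr. pose proof (exp_ineq1_le (ln r)) as h.
rewrite (exp_ln r hr) in h. lra.
Qed.

Lemma ln_lt_sub_1 (r : R) : 0 < r -> r <> 1 -> ln r < r - 1.
Proof.
intros hr hn.
assert (hl : ln r <> 0).
{ intros h. apply hn. rewrite <- (exp_ln r hr), h. apply exp_0. }
pose proof (exp_ineq1 _ hl) as h. rewrite (exp_ln r hr) in h. lra.
Qed.

Lemma le_of_inv_le (r z : R) : 0 < r -> / r <= / z -> z <= r.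
Proof.
intros hr h. rewrite <- (Rinv_inv z), <- (Rinv_inv r).
apply Rinv_le_contravar; [apply Rinv_0_lt_compat |]; assumption.
Qed.

(* The minimizer of [a y - ln y] over [(0, 1]], also when [a <= 0]. *)
Definition clip_inv (a : R) : R := / Rmax 1 a.

Lemma clip_inv_bounds (a : R) : 0 < clip_inv a <= 1.
Proof.
unfold clip_inv. pose proof (Rmax_l 1 a). split.
- apply Rinv_0_lt_compat. lra.
- apply le_of_inv_le; [lra |]. rewrite Rinv_1, Rinv_inv. assumption.
Qed.

Lemma inv_clip_inv_ge (a : R) : a <= / clip_inv a.
Proof. unfold clip_inv. rewrite Rinv_inv. apply Rmax_r. Qed.

Lemma inv_clip_inv (a : R) : 1 <= a -> / clip_inv a = a.
Proof. intros h. unfold clip_inv. rewrite Rinv_inv. apply Rmax_right, h. Qed.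

(** First-order optimality at [s = clip_inv a]: the slope [a - / s] vanishes when [1 <= a];
    otherwise [s = 1], and both the slope and [y - s] are nonpositive. *)
Lemma clip_inv_slope (a y : R) :
  y <= 1 -> 0 <= (y - clip_inv a) * (a - / clip_inv a).
Proof.
intros h1. unfold clip_inv. rewrite Rinv_inv.
destruct (Rle_dec 1 a) as [h | h].
- rewrite Rmax_right by exact h. lra.
- rewrite Rmax_left by lra. rewrite Rinv_1. nra.
Qed.

(** The last bracket is the Bregman divergence of [- ln] between [y] and [s]. It is nonnegative, and
    positive if [y <> s], so only the slope term is left to control. *)
Lemma burg_linear_split (a y s : R) : 0 < y -> 0 < s ->
  a * y - ln y - (a * s - ln s) =
  (y - s) * (a - / s) + (y / s - 1 - ln (y / s)).
Proof. intros hy hs. rewrite ln_div by assumption. field. lra. Qed.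

Lemma clip_inv_le (a y : R) : 0 < y <= 1 ->
  a * clip_inv a - ln (clip_inv a) <= a * y - ln y.
Proof.
intros [h0 h1]. pose proof (clip_inv_bounds a) as [s0 _].
pose proof (burg_linear_split a y _ h0 s0).
pose proof (clip_inv_slope a y h1).
pose proof (ln_le_sub_1 (y / clip_inv a) (Rdiv_lt_0_compat _ _ h0 s0)). lra.
Qed.

Lemma clip_inv_lt (a y : R) : 0 < y <= 1 -> y <> clip_inv a ->
  a * clip_inv a - ln (clip_inv a) < a * y - ln y.
Proof.
intros [h0 h1] hn. pose proof (clip_inv_bounds a) as [s0 _].
pose proof (burg_linear_split a y _ h0 s0).
pose proof (clip_inv_slope a y h1).
assert (y / clip_inv a <> 1).
{ intros e. apply hn. apply (Rmult_eq_compat_r (clip_inv a)) in e.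
  unfold Rdiv in e. rewrite Rmult_assoc, Rinv_l in e by lra. lra. }
pose proof (ln_lt_sub_1 (y / clip_inv a) (Rdiv_lt_0_compat _ _ h0 s0)). lra.
Qed.

(** * Closed form of one step for the Burg kernel *)

Definition bpg_step (f : R * R -> R) (t : R) (x : R * R) : R * R :=
  (clip_inv (/ fst x + t * fst (grad f x)),
   clip_inv (/ snd x + t * snd (grad f x))).

Lemma burg_pos (u : R) : 0 < u -> burg u = Finite (- ln u).
Proof. intros h. unfold burg. destruct (Rlt_dec 0 u); [reflexivity | lra]. Qed.

Lemma burg_nonpos (u : R) : u <= 0 -> burg u = p_infty.
Proof. intros h. unfold burg. destruct (Rlt_dec 0 u); [lra | reflexivity]. Qed.

Lemma separable_burg_pos (y : R * R) : 0 < fst y -> 0 < snd y ->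
  separable burg y = Finite (- ln (fst y) + - ln (snd y)).
Proof.
intros h1 h2. unfold separable. rewrite !burg_pos by assumption. reflexivity.
Qed.

Lemma separable_burg_infty (y : R * R) : fst y <= 0 \/ snd y <= 0 ->
  separable burg y = p_infty.
Proof.
intros h. unfold separable.
destruct (Rle_dec (fst y) 0) as [h1 | h1].
- rewrite (burg_nonpos _ h1). unfold burg. destruct (Rlt_dec 0 (snd y)); reflexivity.
- rewrite (burg_nonpos (snd y)) by (destruct h; lra).
  rewrite burg_pos by lra. reflexivity.
Qed.

Lemma locally_pos (u : R) : 0 < u -> locally u (fun v => 0 < v).
Proof. intros h. exact (open_gt 0 u h). Qed.

Lemma grad_separable_burg (x : R * R) : 0 < fst x -> 0 < snd x ->
  grad (fun z => real (separable burg z)) x = (- / fst x, - / snd x).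
Proof.
intros h1 h2. unfold grad. f_equal.
- apply is_derive_unique.
  apply (is_derive_ext_loc (fun u => - ln u + - ln (snd x))).
  + apply (filter_imp (fun v => 0 < v)); [| now apply locally_pos].
    intros v hv. now rewrite separable_burg_pos.
  + auto_derive; [assumption | ring].
- apply is_derive_unique.
  apply (is_derive_ext_loc (fun u => - ln (fst x) + - ln u)).
  + apply (filter_imp (fun v => 0 < v)); [| now apply locally_pos].
    intros v hv. now rewrite separable_burg_pos.
  + auto_derive; [assumption | ring].
Qed.

(** The part of the model that does not depend on [y]; the [- 2] collects [- x_i / x_i] from the two
    coordinates. *)
Definition burg_model_const (f : R * R -> R) (t : R) (x : R * R) : R :=
  f x - fst (grad f x) * fst x - snd (grad f x) * snd x
  + (ln (fst x) + ln (snd x) - 2) / t.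

Lemma bpg_model_burg_pos (f : R * R -> R) (t : R) (x y : R * R) :
  0 < t -> 0 < fst x -> 0 < snd x -> 0 < fst y -> 0 < snd y ->
  bpg_model f (separable burg) t x y =
  Finite (burg_model_const f t x +
    (((/ fst x + t * fst (grad f x)) * fst y - ln (fst y)) +
     ((/ snd x + t * snd (grad f x)) * snd y - ln (snd y))) / t).
Proof.
intros ht h1 h2 h3 h4. unfold bpg_model, bregman, burg_model_const.
rewrite grad_separable_burg, !separable_burg_pos by assumption.
cbn -[grad]. f_equal. unfold dot. cbn -[grad].
change minus with (fun x y : R * R => plus x (opp y)).
destruct x as [x1 x2], y as [y1 y2]. cbn -[grad] in *.
unfold plus, opp. cbn -[grad]. field. lra.
Qed.

Lemma bpg_model_burg_infty (f : R * R -> R) (t : R) (x y : R * R) :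
  0 < t -> 0 < fst x -> 0 < snd x -> fst y <= 0 \/ snd y <= 0 ->
  bpg_model f (separable burg) t x y = p_infty.
Proof.
intros ht h1 h2 hy. unfold bpg_model, bregman.
rewrite separable_burg_infty, separable_burg_pos by assumption.
set (d := dot _ (minus y x)). set (e := dot _ _).
assert (0 < 1 / t) by (apply Rdiv_lt_0_compat; lra).
(* Finite shifts leave +infinity unchanged, and the positive factor [1 / t] preserves it. *)
change (Rbar_minus (Rbar_minus p_infty _) _) with p_infty.
rewrite (is_Rbar_mult_unique (1 / t) p_infty p_infty); [reflexivity |].
apply is_Rbar_mult_sym, is_Rbar_mult_p_infty_pos. assumption.
Qed.

(** Up to a constant and the factor [1 / t], the model is a sum of two scalar objectives, minimized
    separately by [clip_inv]; points with a zero coordinate have infinite value. *)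
Lemma bpg_step_unique (f : R * R -> R) (t : R) (x : R * R) :
  0 < t -> 0 < fst x -> 0 < snd x ->
  unique (is_argmin unit_square (bpg_model f (separable burg) t x))
    (bpg_step f t x).
Proof.
intros ht h1 h2.
pose proof (clip_inv_bounds (/ fst x + t * fst (grad f x))) as s1.
pose proof (clip_inv_bounds (/ snd x + t * snd (grad f x))) as s2.
assert (hstep := bpg_model_burg_pos f t x (bpg_step f t x) ht h1 h2
  (proj1 s1) (proj1 s2)).
assert (hit : 0 < / t) by (apply Rinv_0_lt_compat; lra).
cbn -[grad] in hstep. split; [split |].
- unfold unit_square. cbn -[grad]. lra.
- intros z [z1 z2].
  destruct (Rle_dec (fst z) 0) as [n1 | p1];
    [rewrite (bpg_model_burg_infty f t x z) by auto; now rewrite hstep |].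
  destruct (Rle_dec (snd z) 0) as [n2 | p2];
    [rewrite (bpg_model_burg_infty f t x z) by auto; now rewrite hstep |].
  rewrite hstep, (bpg_model_burg_pos f t x z) by lra. cbn -[grad].
  apply Rplus_le_compat_l, Rmult_le_compat_r; [lra |].
  apply Rplus_le_compat; apply clip_inv_le; lra.
- intros z [[z1 z2] hz].
  assert (hle : Rbar_le (bpg_model f (separable burg) t x z)
                        (bpg_model f (separable burg) t x (bpg_step f t x))).
  { apply hz. unfold unit_square. cbn -[grad]. lra. }
  rewrite hstep in hle.
  destruct (Rle_dec (fst z) 0) as [n1 | p1];
    [rewrite (bpg_model_burg_infty f t x z) in hle by auto; destruct hle |].
  destruct (Rle_dec (snd z) 0) as [n2 | p2];
    [rewrite (bpg_model_burg_infty f t x z) in hle by auto; destruct hle |].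
  rewrite (bpg_model_burg_pos f t x z) in hle by lra. cbn -[grad] in hle.
  apply Rplus_le_reg_l, Rmult_le_reg_r in hle; [| lra].
  unfold bpg_step. destruct z as [y1 y2]. cbn -[grad] in *.
  pose proof (clip_inv_le (/ fst x + t * fst (grad f x)) y1 ltac:(lra)).
  pose proof (clip_inv_le (/ snd x + t * snd (grad f x)) y2 ltac:(lra)).
  (* [hle] bounds the sum of the scalar objectives at [(y1, y2)] by the sum of their minima, so
     neither coordinate can have a strict gap. *)
  f_equal.
  + destruct (Req_dec y1 (clip_inv (/ fst x + t * fst (grad f x)))); [auto |].
    pose proof (clip_inv_lt (/ fst x + t * fst (grad f x)) y1 ltac:(lra) ltac:(auto)).
    lra.
  + destruct (Req_dec y2 (clip_inv (/ snd x + t * snd (grad f x)))); [auto |].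
    pose proof (clip_inv_lt (/ snd x + t * snd (grad f x)) y2 ltac:(lra) ltac:(auto)).
    lra.
Qed.

Fixpoint bpg_iter (f : R * R -> R) (t : R) (x0 : R * R) (k : nat) : R * R :=
  match k with
  | O => x0
  | S k => bpg_step f t (bpg_iter f t x0 k)
  end.

Lemma bpg_iter_bounds (f : R * R -> R) (t : R) (x0 : R * R) (k : nat) :
  0 < fst x0 <= 1 -> 0 < snd x0 <= 1 ->
  0 < fst (bpg_iter f t x0 k) <= 1 /\ 0 < snd (bpg_iter f t x0 k) <= 1.
Proof.
intros h1 h2. destruct k; [now split | split; apply clip_inv_bounds].
Qed.

Lemma bpg_iter_is_bpg (f : R * R -> R) (t : R) (x0 : R * R) :
  0 < t -> 0 < fst x0 <= 1 -> 0 < snd x0 <= 1 ->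
  is_bpg f (separable burg) unit_square t x0 (bpg_iter f t x0).
Proof.
intros ht h1 h2. split; [reflexivity |]. intros k.
pose proof (bpg_iter_bounds f t x0 k h1 h2) as [b1 b2].
apply bpg_step_unique; lra.
Qed.

(** * Monotonicity and lower bound of [phi_alpha] *)

(** Each branch is nondecreasing on its interval, and adjacent branches agree at the breakpoints
    [alpha], [c] and [c / 2], where [c = alpha * exp (- (1 / alpha))]. *)
Lemma phi_alpha_monotone (alpha x y : R) :
  0 < alpha -> x <= y -> phi_alpha alpha x <= phi_alpha alpha y.
Proof.
intros ha hxy.
set (L := exp (1 / alpha)). set (c := alpha * exp (- (1 / alpha))).
assert (L0 : 0 < L) by apply exp_pos.
assert (L1 : 1 < L).
{ unfold L. pose proof (exp_increasing 0 (1 / alpha)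
    ltac:(apply Rdiv_lt_0_compat; lra)) as h. now rewrite exp_0 in h. }
assert (hc : c * L = alpha).
{ unfold c, L. rewrite exp_Ropp. field. apply Rgt_not_eq, exp_pos. }
assert (c0 : 0 < c) by (unfold c; apply Rmult_lt_0_compat; [lra | apply exp_pos]).
assert (c1 : c < alpha) by nra.
set (p2 := fun x => x + alpha * ln (x / alpha) - alpha).
set (p3 := fun x => x - alpha * ln (x / alpha) + 2 * L * x - 3 * alpha - 2).
set (p4 := fun x => x + alpha * (ln 2 - 2) - 1).
assert (m2 : forall x y, 0 < x -> x <= y -> p2 x <= p2 y).
{ intros u v hu huv. unfold p2.
  assert (ln (u / alpha) <= ln (v / alpha)).
  { apply ln_le; [apply Rdiv_lt_0_compat; lra |].
    apply Rmult_le_compat_r; [left; apply Rinv_0_lt_compat |]; lra. }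
  nra. }
(* The slope [1 - alpha / x + 2 L] is at least 1, since [x >= c / 2] and [c L = alpha] give
   [alpha / x <= 2 L]. The bound [ln r <= r - 1] replaces differentiation. *)
assert (m3 : forall x y, 1 / 2 * c <= x -> x <= y -> p3 x <= p3 y).
{ intros u v hu huv. unfold p3.
  pose proof (ln_le_sub_1 (v / u) ltac:(apply Rdiv_lt_0_compat; lra)) as hl.
  assert (hln : ln (v / alpha) - ln (u / alpha) <= v / u - 1).
  { rewrite !ln_div in * by lra. lra. }
  assert (he : v / u - 1 = (v - u) * / u) by (field; lra).
  assert (hi : / u * alpha <= 2 * L).
  { apply (Rmult_le_reg_l u); [lra |].
    replace (u * (/ u * alpha)) with alpha by (field; lra). nra. }
  assert ((v - u) * (/ u * alpha) <= (v - u) * (2 * L)) by (apply Rmult_le_compat_l; lra).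
  assert (alpha * (ln (v / alpha) - ln (u / alpha)) <= alpha * ((v - u) * / u))
    by (apply Rmult_le_compat_l; lra).
  lra. }
assert (lc : ln (c / alpha) = - (1 / alpha)).
{ replace (c / alpha) with (exp (- (1 / alpha))) by (unfold c; field; lra).
  apply ln_exp. }
assert (ai : alpha * (1 / alpha) = 1) by (field; lra).
assert (j1 : p2 alpha = 2 * alpha - 2 * alpha).
{ unfold p2. replace (alpha / alpha) with 1 by (field; lra). rewrite ln_1. ring. }
assert (j2 : p3 c = p2 c) by (unfold p2, p3; rewrite lc; nra).
assert (j3 : p4 (1 / 2 * c) = p3 (1 / 2 * c)).
{ unfold p3, p4.
  replace (1 / 2 * c / alpha) with (c / alpha / 2) by (field; lra).
  rewrite ln_div, lc by (try lra; apply Rdiv_lt_0_compat; lra). nra. }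
unfold phi_alpha. fold L c.
replace (1 / 2 * alpha * exp (- (1 / alpha))) with (1 / 2 * c) by (unfold c; ring).
fold (p2 x) (p3 x) (p4 x) (p2 y) (p3 y) (p4 y).
(* These comparisons with breakpoint values chain the cases where [x] and [y] lie in different
   branches. *)
assert (j3' : forall u, u <= 1 / 2 * c -> p4 u <= p3 (1 / 2 * c))
  by (intros u hu; rewrite <- j3; unfold p4; lra).
assert (a1 : forall u, c <= u <= alpha -> p2 u <= 0)
  by (intros u hu; pose proof (m2 u alpha); lra).
assert (a2 : forall u, c <= u -> p3 c <= p2 u)
  by (intros u hu; pose proof (m2 c u); lra).
pose proof (m3 (1 / 2 * c) c). pose proof (m3 x c). pose proof (m3 (1 / 2 * c) y).
pose proof (m3 x y). pose proof (m2 x y). pose proof (m2 c alpha).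
pose proof (j3' x). pose proof (a1 x). pose proof (a2 y).
destruct (Rle_dec alpha x); destruct (Rle_dec alpha y);
destruct (Rle_dec c x); destruct (Rle_dec c y);
destruct (Rle_dec (1 / 2 * c) x); destruct (Rle_dec (1 / 2 * c) y);
(* What remains is the case of both points in the lowest branch. *)
try lra. unfold p4; lra.
Qed.

(** By monotonicity it is enough to look at 0, where the value exceeds -1.2. The weaker -4 suffices:
    times [t / 2 = 1 / 4], it costs the reciprocal of [x_2] at most 1 per step. *)
Lemma phi_alpha_ge (alpha x : R) :
  0 < alpha <= 1 / 10 -> 0 <= x -> - 4 <= phi_alpha alpha x.
Proof.
intros ha hx. pose proof (phi_alpha_monotone alpha 0 x (proj1 ha) hx) as h.
pose proof (exp_pos (- (1 / alpha))).
pose proof ln_lt_2.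
assert (phi_alpha alpha 0 = 0 + alpha * (ln 2 - 2) - 1).
{ unfold phi_alpha.
  destruct (Rle_dec alpha 0); [lra |].
  destruct (Rle_dec (alpha * exp (- (1 / alpha))) 0); [nra |].
  destruct (Rle_dec (1 / 2 * alpha * exp (- (1 / alpha))) 0); [nra |].
  reflexivity. }
nra.
Qed.

(** * Partial derivatives of [f_alpha] *)

(** Saves checking differentiability of [phi_alpha] at its breakpoints: [Derive] is the real part of
    a limit of difference quotients along a fixed sequence, and all of these are nonnegative. *)
Lemma Derive_monotone_ge_0 (f : R -> R) (x : R) :
  (forall u v, u <= v -> f u <= f v) -> 0 <= Derive f x.
Proof.
intros hf. unfold Derive.
set (g := fun h => (f (x + h) - f x) / h).
assert (hg : Rbar_le 0 (Lim g 0)).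
{ change (Rbar_le (Finite 0) (Lim_seq (fun n => g (Rbar_loc_seq (Finite 0) n)))).
  pose proof (Lim_seq_const 0) as h0. rewrite <- h0 at 1. apply Lim_seq_le_loc.
  exists 0%nat. intros n _. unfold g.
  assert (hn : 0 < Rbar_loc_seq 0 n).
  { cbn. pose proof (RinvN_pos n). lra. }
  apply Rmult_le_pos; [| left; apply Rinv_0_lt_compat, hn].
  pose proof (hf x (x + Rbar_loc_seq 0 n)). lra. }
(* [hg] excludes -infinity, and [real] sends +infinity to 0. *)
destruct (Lim g 0); cbn in *; lra.
Qed.

Lemma grad_f_alpha_fst_ge_0 (alpha : R) (x : R * R) :
  0 < alpha -> 0 <= snd x -> 0 <= fst (grad (f_alpha alpha) x).
Proof.
intros ha hx. apply Derive_monotone_ge_0. intros u v huv.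
unfold f_alpha; cbn -[phi_alpha].
pose proof (phi_alpha_monotone alpha u v ha huv). nra.
Qed.

Lemma grad_f_alpha_fst (alpha : R) (x : R * R) :
  alpha < fst x -> fst (grad (f_alpha alpha) x) = snd x + 5 / 100.
Proof.
intros hx. apply is_derive_unique.
apply (is_derive_ext_loc (fun u => (u - alpha) * (snd x + 5 / 100))).
- apply (filter_imp (fun v => alpha < v)); [| exact (open_gt alpha _ hx)].
  intros v hv. unfold f_alpha, phi_alpha. cbn.
  destruct (Rle_dec alpha v); lra.
- auto_derive; [exact I | ring].
Qed.

Lemma grad_f_alpha_snd (alpha : R) (x : R * R) :
  snd (grad (f_alpha alpha) x) = 1 / 2 * phi_alpha alpha (fst x).
Proof.
apply is_derive_unique. unfold f_alpha. cbn -[phi_alpha].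
auto_derive; [exact I | ring].
Qed.

(** * Growth of the reciprocals along the iteration *)

Lemma f_alpha_step_fst (alpha : R) (x : R * R) :
  0 < alpha -> 0 <= snd x ->
  / fst x <= / fst (bpg_step (f_alpha alpha) (1 / 2) x).
Proof.
intros ha hx. pose proof (grad_f_alpha_fst_ge_0 alpha x ha hx).
cbn -[grad]. eapply Rle_trans; [| apply inv_clip_inv_ge]. lra.
Qed.

Lemma f_alpha_step_snd (alpha : R) (x : R * R) :
  0 < alpha <= 1 / 10 -> 0 <= fst x ->
  / snd x - 1 <= / snd (bpg_step (f_alpha alpha) (1 / 2) x).
Proof.
intros ha hx. pose proof (phi_alpha_ge alpha (fst x) ha hx).
unfold bpg_step, snd at 2. rewrite grad_f_alpha_snd.
eapply Rle_trans; [| apply inv_clip_inv_ge]. lra.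
Qed.

(** The upper bound on [/ fst x] keeps [x_1] at least [2 alpha], on the first branch of [phi_alpha],
    so [/ snd x] gains [(x_1 - alpha) / 2 >= x_1 / 4]. The bound [10 <= / snd x] gives
    [x_2 <= 1 / 10], so [/ fst x] gains between [1 / 40] and [3 / 40]. *)
Lemma f_alpha_transient (alpha : R) (N k : nat) :
  0 < alpha -> alpha * (2 * (INR N + 2)) = 1 -> (k <= N)%nat ->
  let x := bpg_iter (f_alpha alpha) (1 / 2) (1, 1 / 10) k in
  1 + INR k / 40 <= / fst x <= INR k + 1 /\
  10 <= / snd x /\ ln (INR k + 1) / 4 <= / snd x.
Proof.
intros ha hN. induction k as [| k IH]; intros hk x.
- cbn. rewrite Rplus_0_l, ln_1, Rinv_1. lra.
- specialize (IH ltac:(lia)). unfold x. cbn [bpg_iter].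
  pose proof (bpg_iter_bounds (f_alpha alpha) (1 / 2) (1, 1 / 10) k
    ltac:(cbn; lra) ltac:(cbn; lra)) as b.
  set (y := bpg_iter _ _ _ k) in *. clearbody y. clear x.
  cbv zeta in IH. destruct IH as ((l1 & l2) & l3 & l4).
  pose proof (pos_INR k) as k0.
  assert (kN : INR k + 1 <= INR N).
  { rewrite <- S_INR. apply le_INR, hk. }
  assert (y1 : / (INR k + 1) <= fst y).
  { apply le_of_inv_le; [lra |]. rewrite Rinv_inv. lra. }
  assert (y2 : snd y <= 1 / 10).
  { apply le_of_inv_le; lra. }
  assert (ya : 2 * alpha <= / (INR k + 1)).
  { apply (Rmult_le_reg_r (INR k + 1)); [lra |]. rewrite Rinv_l by lra. nra. }
  assert (hphi : phi_alpha alpha (fst y) = 2 * fst y - 2 * alpha).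
  { unfold phi_alpha. destruct (Rle_dec alpha (fst y)); lra. }
  unfold bpg_step. cbn [fst snd].
  rewrite grad_f_alpha_snd, grad_f_alpha_fst, hphi by lra.
  (* Both arguments are at least 1, so the clipping is inactive. *)
  rewrite !inv_clip_inv by lra. rewrite S_INR.
  (* The logarithm grows no faster than the harmonic sum. *)
  assert (hln : ln (INR k + 1 + 1) - ln (INR k + 1) <= / (INR k + 1)).
  { pose proof (ln_le_sub_1 ((INR k + 1 + 1) / (INR k + 1))
      ltac:(apply Rdiv_lt_0_compat; lra)) as h.
    rewrite ln_div in h by lra.
    replace ((INR k + 1 + 1) / (INR k + 1) - 1) with (/ (INR k + 1)) in h
      by (field; lra).
    exact h. }
  repeat split; lra.
Qed.

Lemma f_alpha_plateau (alpha : R) (N j : nat) :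
  0 < alpha <= 1 / 10 ->
  let x := bpg_iter (f_alpha alpha) (1 / 2) (1, 1 / 10) in
  / fst (x N) <= / fst (x (j + N)%nat) /\
  / snd (x N) - INR j <= / snd (x (j + N)%nat).
Proof.
intros ha x. induction j as [| j IH].
- cbn. lra.
- pose proof (bpg_iter_bounds (f_alpha alpha) (1 / 2) (1, 1 / 10) (j + N)
    ltac:(cbn; lra) ltac:(cbn; lra)) as b.
  fold x in b.
  (* With [j] on the left, [S j + N] reduces to [S (j + N)], so the iterate unfolds by
     computation. *)
  change (x (S j + N)%nat) with (bpg_step (f_alpha alpha) (1 / 2) (x (j + N)%nat)).
  pose proof (f_alpha_step_fst alpha (x (j + N)%nat) ltac:(lra) ltac:(lra)).
  pose proof (f_alpha_step_snd alpha (x (j + N)%nat) ltac:(lra) ltac:(lra)).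
  rewrite S_INR. lra.
Qed.

(** * Entering the ball: choice of [N] and [alpha] *)

Lemma eball_origin (eps : R) (x : R * R) :
  0 <= fst x <= eps / 2 -> 0 <= snd x <= eps / 2 -> eball eps (0, 0) x.
Proof.
intros h1 h2. destruct x as [u v]. cbn [fst snd] in *. unfold eball.
change (sqrt (Rabs (0 + - u) ^ 2 + Rabs (0 + - v) ^ 2) <= eps).
rewrite !pow2_abs, <- (sqrt_pow2 eps) by lra.
apply sqrt_le_1_alt. nra.
Qed.

Theorem mainTheorem4 :
  forall (K : nat) (eps : R), 0 < eps <= 1 ->
  exists alpha : R, 0 < alpha <= 1 / 10 /\
  exists x : nat -> R * R,
    is_bpg (f_alpha alpha) (separable burg) unit_square (1 / 2) (1, 1 / 10) x /\
    exists k1 : nat, (0 < k1)%nat /\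
      forall k : nat, (k1 <= k <= K + k1)%nat -> eball eps (0, 0) (x k).
Proof.
intros K eps he.
(* Once both reciprocals reach [M], both coordinates are at most [eps / 2]. *)
set (M := / (eps / 2)).
assert (M0 : 2 <= M).
{ unfold M. replace 2 with (/ (1 / 2)) at 1 by lra. apply Rinv_le_contravar; lra. }
(* The exponential gives [ln (N + 1) / 4 >= M + K], which leaves room for [K] drops of 1; the term
   [40 * M] gives [1 + N / 40 >= M]. *)
destruct (INR_unbounded (exp (4 * (M + INR K)) + 40 * M)) as [N hN].
pose proof (exp_pos (4 * (M + INR K))) as E0.
set (alpha := / (2 * (INR N + 2))).
assert (a0 : 0 < alpha) by (apply Rinv_0_lt_compat; lra).
assert (a1 : alpha * (2 * (INR N + 2)) = 1) by (apply Rinv_l; lra).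
(* Here [N > 40 * M >= 80]. *)
assert (ha : 0 < alpha <= 1 / 10) by nra.
exists alpha. split; [exact ha |].
exists (bpg_iter (f_alpha alpha) (1 / 2) (1, 1 / 10)).
split; [apply bpg_iter_is_bpg; cbn; lra |].
exists N. split; [apply INR_lt; cbn; lra |].
intros k [k1 k2]. replace k with ((k - N) + N)%nat by lia.
assert (hj : INR (k - N) <= INR K) by (apply le_INR; lia).
pose proof (f_alpha_transient alpha N N a0 a1 (le_n N)) as ((u1 & _) & _ & v1).
pose proof (f_alpha_plateau alpha N (k - N) ha) as (u2 & v2).
pose proof (bpg_iter_bounds (f_alpha alpha) (1 / 2) (1, 1 / 10) (k - N + N)
  ltac:(cbn; lra) ltac:(cbn; lra)) as b.
assert (hl : 4 * (M + INR K) <= ln (INR N + 1)).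
{ rewrite <- (ln_exp (4 * (M + INR K))). apply ln_le; lra. }
apply eball_origin; (split; [lra |]); apply le_of_inv_le; fold M; lra.
Qed.
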